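(* There is no $1$-vector field $\mathcal{X}=\mathcal{X}(\mathcal{P})$ encoded by (a real linear combination of) Kontsevich graphs with one sink and no operator $\nabla$ encoded by (a real linear combination of) Leibniz graphs with two sinks such that $$\mathcal{Q}_{1:6}(\mathcal{P})=[\![\mathcal{P},\mathcal{X}(\mathcal{P})]\!]+\nabla(\mathcal{P},\mathrm{Jac}(\mathcal{P}))$$ holds universally, i.e. for all bi-vectors $\mathcal{P}$ on all affine real manifolds $N^n$ of all finite dimensions $n\geqslant 2$.
   Context: An affine real manifold $N^n$ is a smooth real manifold with an atlas whose coordinate changes are affine; coordinate formulas are in charts $(x^1,\dots,x^n)$ of that atlas, $\partial_i=\partial/\partial x^i$, and repeated indices are summed from $1$ to $n$. A bi-vector is $\mathcal{P}=\mathcal{P}^{ij}\,\partial_i\wedge\partial_j$ with $\mathcal{P}^{ij}=-\mathcal{P}^{ji}$; $[\![\cdot,\cdot]\!]$ is the Schouten bracket of multivector fields. The Jacobiator $\mathrm{Jac}(\mathcal{P})$, equal to $[\![\mathcal{P},\mathcal{P}]\!]$ up to a nonzero constant, is the tri-vector with totally antisymmetric coefficients $\mathrm{Jac}^{abc}=\partial_s\mathcal{P}^{ab}\mathcal{P}^{sc}+\partial_s\mathcal{P}^{bc}\mathcal{P}^{sa}+\partial_s\mathcal{P}^{ca}\mathcal{P}^{sb}$. The velocity of the Kontsevich tetrahedral flow is $\mathcal{Q}_{1:6}(\mathcal{P})=\tfrac14\Gamma_1(\mathcal{P})+\tfrac32\Gamma_2(\mathcal{P})$, where $$\Gamma_1(\mathcal{P})=\bigl(\partial_k\partial_\ell\partial_m\mathcal{P}^{ij}\;\partial_{\ell'}\mathcal{P}^{kk'}\;\partial_{m'}\mathcal{P}^{\ell\ell'}\;\partial_{k'}\mathcal{P}^{mm'}\bigr)\,\partial_i\wedge\partial_j,$$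 $$\Gamma_2(\mathcal{P})=\bigl(\partial_k\partial_\ell\mathcal{P}^{ij}\;\partial_{k'}\partial_{\ell'}\mathcal{P}^{km}\;\partial_{m'}\mathcal{P}^{k'\ell}\;\partial_{j}\mathcal{P}^{m'\ell'}\bigr)\,\partial_i\wedge\partial_m.$$ Kontsevich graphs. A Kontsevich graph is a finite oriented graph whose vertices are either ordered sinks (no outgoing arrows) or internal vertices, each being the source of exactly two arrows, which are ordered (left $\prec$ right); tadpoles and two-cycles are allowed. It encodes a polydifferential operator (depending on $\mathcal{P}$) whose arguments are placed in the sinks: attach a summation index to each arrow; take the product of the contents of all vertices, the content of an internal vertex being $\mathcal{P}^{ij}$ with $i,j$ the indices of its left and right outgoing arrows and the content of a sink being the corresponding argument; apply to each vertex content the derivatives $\partial_i$ for all the indices of its incoming arrows; sum over all indices. Leibniz graphs. A Leibniz graph is a graph whose vertices are sinks, internal vertices with two ordered outgoing arrows (containing $\mathcal{P}$), or Jacobiator vertices with three ordered outgoing arrows landing on three distinct vertices; there is at least one Jacobiator vertex. The operator it encodes is obtained by the same rule, the content of a Jacobiator vertex being $\mathrm{Jac}^{abc}$ with $a,b,c$ the indices of its outgoing arrows; arrows falling on a Jacobiator vertex thus act on $\mathrm{Jac}^{abc}$ by the Leibniz rule on the two copies of $\mathcal{P}$ in it. *)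

(* Defs.v *)
From HB Require Import structures.
From mathcomp Require Import all_boot all_order all_algebra.
From mathcomp Require Import all_classical all_reals all_analysis.
Import Order.TTheory GRing.Theory Num.Theory.
Import numFieldNormedType.Exports.

Set Implicit Arguments.
Unset Strict Implicit.
Unset Printing Implicit Defensive.

Local Open Scope classical_set_scope.
Local Open Scope ring_scope.

(* Functions given on an open subset of R^n are represented by total functions
   on row vectors; only their values on that open subset are meaningful. *)

Section Calculus.
Variables (R : realType) (n : nat).
Implicit Types (f g : 'rV[R]_n -> R) (I : seq 'I_n) (x : 'rV[R]_n).

Definition partial (i : 'I_n) f : 'rV[R]_n -> R :=
  fun x => 'D_(delta_mx 0 i) f x.

Definition partials I f : 'rV[R]_n -> R := foldr partial f I.

(* Differentiability of all iterated partial derivatives is C^oo on an open U. *)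
Definition smooth_on (U : set 'rV[R]_n) f : Prop :=
  forall I x, U x -> differentiable (partials I f) x.

(* The action of T^{ij} d_i /\ d_j on a pair of functions, normalised by
   d_i /\ d_j = (d_i (x) d_j - d_j (x) d_i) / 2, so that a bi-vector P acts by
   P^{ij} d_i f d_j g.  The coefficients T need not be skew. *)
Definition wedge_action (T : 'I_n -> 'I_n -> 'rV[R]_n -> R) f g x : R :=
  2^-1 * \sum_i \sum_j
    T i j x * (partial i f x * partial j g x - partial j f x * partial i g x).

(* Coefficients, with respect to d_i /\ d_j, of the Schouten bracket of a
   bi-vector P and a 1-vector X.  With odd coordinates xi_i for d_i it is
     (P <-d/dxi_s) (d/dx^s X) - (P <-d/dx^s) (d/dxi_s X),
   for P = P^{ij} xi_i xi_j and X = X^i xi_i, that is, minus the Lie derivative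
   of P along X. *)
Definition schouten21 (P : 'I_n -> 'I_n -> 'rV[R]_n -> R)
    (X : 'I_n -> 'rV[R]_n -> R) (i j : 'I_n) x : R :=
  \sum_s (P i s x * partial s (X j) x - P j s x * partial s (X i) x
          - X s x * partial s (P i j) x).

Definition Jac (P : 'I_n -> 'I_n -> 'rV[R]_n -> R) (a b c : 'I_n) x : R :=
  \sum_s (partial s (P a b) x * P s c x + partial s (P b c) x * P s a x
          + partial s (P c a) x * P s b x).

Definition Gamma1 (P : 'I_n -> 'I_n -> 'rV[R]_n -> R) (i j : 'I_n) x : R :=
  \sum_k \sum_l \sum_m \sum_k' \sum_l' \sum_m'
    partials [:: k; l; m] (P i j) x * partial l' (P k k') x *
    partial m' (P l l') x * partial k' (P m m') x.

(* The wedge here is d_i /\ d_m. *)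
Definition Gamma2 (P : 'I_n -> 'I_n -> 'rV[R]_n -> R) (i m : 'I_n) x : R :=
  \sum_j \sum_k \sum_l \sum_k' \sum_l' \sum_m'
    partials [:: k; l] (P i j) x * partials [:: k'; l'] (P k m) x *
    partial m' (P k' l) x * partial j (P m' l') x.

(* In general not skew in (i, j): to be used through [wedge_action]. *)
Definition Q16 (P : 'I_n -> 'I_n -> 'rV[R]_n -> R) (i j : 'I_n) x : R :=
  1 / 4%:R * Gamma1 P i j x + 3%:R / 2%:R * Gamma2 P i j x.

End Calculus.

(* Oriented graphs with m ordered sinks, [gwedges] vertices with two ordered
   outgoing arrows (false is the left one) and [gjacs] vertices with three
   ordered outgoing arrows. *)

Definition gvertex (m w j : nat) : Type := ('I_m + ('I_w + 'I_j))%type.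

Record graph (m : nat) := Graph {
  gwedges : nat;
  gjacs : nat;
  wtarget : 'I_gwedges -> bool -> gvertex m gwedges gjacs;
  jtarget : 'I_gjacs -> 'I_3 -> gvertex m gwedges gjacs
}.

Definition is_kontsevich m (G : graph m) : bool := gjacs G == 0%N.

Definition is_leibniz m (G : graph m) : bool :=
  (0 < gjacs G)%N && [forall v : 'I_(gjacs G), injectiveb (@jtarget m G v)].

Section GraphOperators.
Variables (R : realType) (n m : nat).

Definition arrow (G : graph m) : Type :=
  ('I_(gwedges G) * bool + 'I_(gjacs G) * 'I_3)%type.

Definition target (G : graph m) (e : arrow G) :
    gvertex m (gwedges G) (gjacs G) :=
  match e with
  | inl (v, b) => wtarget v b
  | inr (v, r) => jtarget v r
  end.

Definition incoming (G : graph m) (idx : {ffun arrow G -> 'I_n})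
    (v : gvertex m (gwedges G) (gjacs G)) : seq 'I_n :=
  [seq idx e | e <- enum {: arrow G} & target e == v].

Definition graph_op (G : graph m) (P : 'I_n -> 'I_n -> 'rV[R]_n -> R)
    (args : 'I_m -> 'rV[R]_n -> R) (x : 'rV[R]_n) : R :=
  \sum_(idx : {ffun arrow G -> 'I_n})
    (\prod_(s < m) partials (incoming idx (inl s)) (args s) x) *
    (\prod_(v < gwedges G)
        partials (incoming idx (inr (inl v)))
          (P (idx (inl (v, false))) (idx (inl (v, true)))) x) *
    (\prod_(v < gjacs G)
        partials (incoming idx (inr (inr v)))
          (Jac P (idx (inr (v, inord 0))) (idx (inr (v, inord 1)))
                 (idx (inr (v, inord 2)))) x).

Definition comb_op (C : seq (R * graph m))
    (P : 'I_n -> 'I_n -> 'rV[R]_n -> R)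
    (args : 'I_m -> 'rV[R]_n -> R) (x : 'rV[R]_n) : R :=
  \sum_(t <- C) t.1 * graph_op t.2 P args x.

End GraphOperators.

(* Points of R^n are row vectors, so an affine map is y = x *m A + c and its
   Jacobian d y^k / d x^i is A i k.  The coordinate changes of an atlas are
   affine near each point of the overlap of two charts (an overlap may be
   disconnected). *)
Record affine_manifold (R : realType) (n : nat) := AffineManifold {
  am_space :> topologicalType;
  am_hausdorff : hausdorff_space am_space;
  am_second_countable : @second_countable am_space;
  am_chart : Type;
  am_dom : am_chart -> set am_space;
  am_coord : am_chart -> am_space -> 'rV[R]_n;
  am_point : am_chart -> 'rV[R]_n -> am_space;
  am_cover : forall p : am_space, exists a, am_dom a p;
  am_dom_open : forall a, open (am_dom a);
  am_img_open : forall a, open (am_coord a @` am_dom a);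
  am_coordK : forall a p, am_dom a p -> am_point a (am_coord a p) = p;
  am_coord_continuous : forall a p, am_dom a p ->
    {for p, continuous (am_coord a)};
  am_point_continuous : forall a x, (am_coord a @` am_dom a) x ->
    {for x, continuous (am_point a)};
  am_affine : forall a b p, am_dom a p -> am_dom b p ->
    exists (A : 'M[R]_n) (c : 'rV[R]_n),
      \forall q \near p, am_coord b q = am_coord a q *m A + c
}.

Section AffineManifolds.
Variables (R : realType) (n : nat) (N : affine_manifold R n).

Definition am_img (a : am_chart N) : set 'rV[R]_n := am_coord a @` am_dom a.

Definition transition_jacobian (a b : am_chart N) (p : N) (A : 'M[R]_n) : Prop :=
  exists c : 'rV[R]_n,
    \forall q \near p, am_coord b q = am_coord a q *m A + c.

Definition in_chart (f : N -> R) (a : am_chart N) : 'rV[R]_n -> R :=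
  f \o am_point a.

Definition smooth_function (f : N -> R) : Prop :=
  forall a, smooth_on (am_img a) (in_chart f a).

Record bivector := Bivector {
  bv_coef :> am_chart N -> 'I_n -> 'I_n -> 'rV[R]_n -> R;
  bv_smooth : forall a i j, smooth_on (am_img a) (bv_coef a i j);
  bv_skew : forall a i j x, am_img a x -> bv_coef a i j x = - bv_coef a j i x;
  bv_tensor : forall a b p A, am_dom a p -> am_dom b p ->
    transition_jacobian a b p A ->
    forall k l, bv_coef b k l (am_coord b p) =
      \sum_i \sum_j bv_coef a i j (am_coord a p) * A i k * A j l
}.

Record vector_field := VectorField {
  vf_coef :> am_chart N -> 'I_n -> 'rV[R]_n -> R;
  vf_smooth : forall a i, smooth_on (am_img a) (vf_coef a i);
  vf_tensor : forall a b p A, am_dom a p -> am_dom b p ->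
    transition_jacobian a b p A ->
    forall k, vf_coef b k (am_coord b p) =
      \sum_i vf_coef a i (am_coord a p) * A i k
}.

(* On (N, P), the combination C of one-sink graphs encodes the derivation
   f |-> V^i d_i f of the smooth functions. *)
Definition encodes_vector_field (C : seq (R * graph 1)) (P : bivector)
    (V : vector_field) : Prop :=
  forall f, smooth_function f -> forall a x, am_img a x ->
    comb_op C (P a) (fun=> in_chart f a) x =
    \sum_i V a i x * partial i (in_chart f a) x.

(* Q_{1:6}(P) = [[P, V]] + D(P, Jac P), as bi-differential operators on N. *)
Definition factorizes (D : seq (R * graph 2)) (P : bivector)
    (V : vector_field) : Prop :=
  forall f g, smooth_function f -> smooth_function g ->
  forall a x, am_img a x ->
    wedge_action (Q16 (P a)) (in_chart f a) (in_chart g a) x =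
    wedge_action (schouten21 (P a) (V a)) (in_chart f a) (in_chart g a) x
    + comb_op D (P a) (tnth [tuple in_chart f a; in_chart g a]) x.

End AffineManifolds.

(* Main.v *)
Require Import Defs.
From mathcomp Require Import all_boot all_order all_fingroup all_algebra.
From mathcomp Require Import all_classical all_reals all_analysis.
From mathcomp Require Import zify ring lra.
Import Order.TTheory GRing.Theory Num.Theory.
Import numFieldNormedType.Exports.

(** One Poisson structure on R^4 refutes the factorization.  With coordinates
    (x0, x1, x2, x3) it is the Nambu-Poisson bracket [nambu] whose Casimirs are
    C1 = x2 + x3^3/3 and C2 = x0^2/2 + x1^3/3 + x2^2/2:

      P01 = - x2 x3^2,  P02 = x1^2 x3^2,  P03 = - x1^2,
      P12 = - x0 x3^2,  P13 = x0,         P23 = 0.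

    Since Jac(P) = 0, every Leibniz graph gives the zero operator, so what has
    to be refuted is Q(P) = [[P, X(P)]].  Replace P by tP.  A graph with k
    internal vertices is homogeneous of degree k in P, so comparing the
    coefficients of t^4 leaves only the one-sink graphs with three internal
    vertices ([coef_power_sum]).

    These are few, because each P^{ij} is independent of x_i and x_j.  Hence a
    tadpole makes every term of a graph vanish ([graph_field_tadpole]), and two
    parallel arrows make the graph equal to its opposite by skew-symmetry
    ([graph_field_double]).  Up to renumbering the vertices and swapping the
    two arrows of a vertex, which only changes the sign ([graph_field_iso]), a
    single graph remains ([graph_field_three]); its vector field is
      W^a = d_j d_l P^{ai}  d_i d_m P^{jk}  d_k P^{lm}.
    So the universal field X would have to act on P as a multiple c W.

    For the chosen P one has W = (4 x3^3, 0, - 4 x0, 0), and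
      [[P, W]]^{23} = 4 x1^2    while  Q(P)^{23} = 0,
      [[P, W]]^{13} = - 4 x3^3  while  Q(P)^{13} = - 3 x3^3.
    The first line forces c = 0 and the second one c = 3/4.

    The coefficients of P are polynomials with integer coefficients, and these
    are handled syntactically, so that the identities about the concrete P are
    checked by computation. *)

Set Implicit Arguments.
Unset Strict Implicit.
Unset Printing Implicit Defensive.

Local Open Scope classical_set_scope.
Local Open Scope ring_scope.

(** * Polynomials with integer coefficients *)

(** A monomial is a coefficient and the list of the exponents of x_0, x_1, ...;
    exponents beyond the end of the list are 0. *)
Definition mono : Type := (int * seq nat)%type.
Definition ipoly : Type := seq mono.

Definition dmono (i : nat) (m : mono) : mono :=
  (m.1 * (nth 0%N m.2 i)%:Z, set_nth 0%N m.2 i (nth 0%N m.2 i).-1).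
Definition dpoly (i : nat) (p : ipoly) : ipoly := [seq dmono i m | m <- p].
Definition dpolys (I : seq nat) (p : ipoly) : ipoly := foldr dpoly p I.

Definition mmul (m m' : mono) : mono :=
  (m.1 * m'.1, mkseq (fun i => (nth 0 m.2 i + nth 0 m'.2 i)%N)
                     (maxn (size m.2) (size m'.2))).
Definition pmul (p q : ipoly) : ipoly := [seq mmul m m' | m <- p, m' <- q].
Definition popp (p : ipoly) : ipoly := [seq (- m.1, m.2) | m <- p].
Definition psum (n : nat) (F : nat -> ipoly) : ipoly :=
  flatten [seq F i | i <- iota 0 n].

(** Cancellation between the members of a list of monomials only shows after
    like terms have been merged: [collect] turns the lists that vanish in this
    way into the empty one. *)
Fixpoint insert_mono (m : mono) (p : ipoly) : ipoly :=
  if p is m' :: p' then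
    if m'.2 == m.2 then (m'.1 + m.1, m.2) :: p' else m' :: insert_mono m p'
  else [:: m].
Definition collect (p : ipoly) : ipoly :=
  [seq m <- foldr insert_mono [::] [seq m <- p | m.1 != 0] | m.1 != 0].

Definition sum_coefs (p : ipoly) : int := foldr (fun m s => m.1 + s) 0 p.

Lemma dmonoC i j m : dmono i (dmono j m) = dmono j (dmono i m).
Proof.
have [->//|nij] := eqVneq i j.
rewrite /dmono /= !nth_set_nth /= [j == i]eq_sym (negPf nij).
by rewrite mulrAC set_set_nth eq_sym (negPf nij).
Qed.

Lemma dpolyC i j p : dpoly i (dpoly j p) = dpoly j (dpoly i p).
Proof. by rewrite /dpoly -!map_comp; apply: eq_map => m; exact: dmonoC. Qed.

Lemma dpolys_dpoly I i p : dpolys I (dpoly i p) = dpoly i (dpolys I p).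
Proof. by elim: I => //= j I ->; rewrite dpolyC. Qed.

Lemma perm_dpolys I J p : perm_eq I J -> dpolys I p = dpolys J p.
Proof.
move=> IJ; apply/esym; move: IJ (erefl (dpolys I p)).
apply: (@catCA_perm_ind _ (fun K => dpolys K p = dpolys I p)) => s1 s2 s3 <-.
rewrite /dpolys !foldr_cat; move: (foldr dpoly p s3) => q.
by elim: s1 => //= i s1 <-; rewrite -/(dpolys s2 _) dpolys_dpoly.
Qed.

Lemma poppK : involutive popp.
Proof.
move=> q; rewrite /popp -map_comp -[RHS]map_id; apply: eq_map => -[c e].
by rewrite /= opprK.
Qed.

Lemma dpolys_popp I q : dpolys I (popp q) = popp (dpolys I q).
Proof.
elim: I => //= i I ->; rewrite /dpoly /popp -!map_comp; apply: eq_map => m /=.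
by rewrite /dmono /= mulNr.
Qed.

Section Evaluation.
Variables (R : realType) (n : nat).
Implicit Types (p q : ipoly) (x : 'rV[R]_n).

Definition evm (m : mono) x : R :=
  m.1%:~R * \prod_(i < n) x 0 i ^+ nth 0%N m.2 i.
Definition ev p x : R := \sum_(m <- p) evm m x.

Lemma ev_cat p q x : ev (p ++ q) x = ev p x + ev q x.
Proof. exact: big_cat. Qed.

Lemma ev_opp p x : ev (popp p) x = - ev p x.
Proof.
rewrite /ev big_map -sumrN; apply: eq_bigr => m _.
by rewrite /evm /= mulrNz mulNr.
Qed.

Lemma evm_mul m m' x : evm (mmul m m') x = evm m x * evm m' x.
Proof.
rewrite /evm /= intrM mulrACA -big_split /=; congr (_ * _).
apply: eq_bigr => i _; rewrite -exprD; congr (_ ^+ _).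
have [lt|ge] := ltnP i (maxn (size m.2) (size m'.2)); first exact: nth_mkseq.
rewrite nth_default ?size_mkseq//; move: ge; rewrite geq_max => /andP[h1 h2].
by rewrite !nth_default.
Qed.

Lemma ev_mul p q x : ev (pmul p q) x = ev p x * ev q x.
Proof.
rewrite /ev /pmul big_allpairs_dep mulr_suml; apply: eq_bigr => m _.
by rewrite mulr_sumr; apply: eq_bigr => m' _; exact: evm_mul.
Qed.

Lemma ev_sum (F : nat -> ipoly) x : ev (psum n F) x = \sum_(i < n) ev (F i) x.
Proof.
rewrite /ev /psum big_flatten big_map -[n in iota 0 n]subn0.
by rewrite -/(index_iota 0 n) big_mkord.
Qed.

Lemma ev_collect p x : ev (collect p) x = ev p x.
Proof.
have ev_nz q : ev [seq m <- q | m.1 != 0] x = ev q x.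
  rewrite /ev big_filter big_rmcond // => m /negPn/eqP m0.
  by rewrite /evm m0 mul0r.
rewrite /collect ev_nz -[RHS]ev_nz; elim: [seq m <- p | _] => //= m q IH.
rewrite [RHS]/ev big_cons -/(ev _ _) -{}IH.
elim: (foldr _ _ _) => [|m' r IH] /=.
  by rewrite /ev big_seq1 big_nil addr0.
rewrite /ev; case: eqP => [e|_]; rewrite !big_cons -!/(ev _ _).
  by rewrite addrA; congr (_ + _); rewrite /evm /= e intrD mulrDl addrC.
by rewrite IH addrCA.
Qed.

Lemma ev_ones p : ev p (const_mx 1) = (sum_coefs p)%:~R.
Proof.
elim: p => [|m p IH]; first by rewrite /ev big_nil.
rewrite /ev big_cons -/(ev _ _) IH /= intrD; congr (_ + _).
by rewrite /evm big1 ?mulr1// => i _; rewrite mxE expr1n.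
Qed.

Lemma differentiable_ev p x : differentiable (ev p) x.
Proof.
have dm m : differentiable (evm m) x.
  rewrite (_ : evm m = cst m.1%:~R *
    \prod_(i < n) (fun y : 'rV[R]_n => y 0 i ^+ nth 0%N m.2 i)); last first.
    by apply/funext => y; rewrite fct_prodE.
  apply: differentiableM; first exact: differentiable_cst.
  elim/big_ind: _ => [|f g|i _]; first exact: differentiable_cst.
  - exact: differentiableM.
  - rewrite -exprfctE; case: (nth _ _ _) => [|k]; first exact: differentiable_cst.
    by apply: differentiableX; exact: differentiable_coord.
rewrite (_ : ev p = \sum_(m <- p) evm m); last first.
  by apply/funext => y; rewrite fct_sumE.
elim/big_ind: _ => [|f g|m _]; first exact: differentiable_cst.
- exact: differentiableD.
- exact: dm.
Qed.

Lemma is_derive_coord (i j : 'I_n) x :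
  is_derive x (delta_mx 0 i) (fun y : 'rV[R]_n => y 0 j) (i == j)%:R.
Proof.
apply: DeriveDef; first exact/diff_derivable/differentiable_coord.
have @f : {linear 'rV[R]_n -> R}.
  by exists (fun y : 'rV[R]_n => y 0 j); do 2![eexists]; do ?[constructor];
     rewrite ?mxE// => ? *; rewrite ?mxE//; move=> ?; rewrite !mxE.
rewrite (_ : (fun y : 'rV[R]_n => y 0 j) = f) // deriveE; last first.
  exact/linear_differentiable/coord_continuous.
rewrite diff_lin; last exact: coord_continuous.
by rewrite /= mxE eqxx eq_sym.
Qed.

Lemma is_derive_evm (i : 'I_n) m x :
  is_derive x (delta_mx 0 i) (evm m) (evm (dmono i m) x).
Proof.
pose F j (y : 'rV[R]_n) := y 0 j ^+ nth 0%N m.2 j.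
pose rest := \prod_(j < n | j != i) F j.
have drest : is_derive x (delta_mx 0 i) rest 0.
  rewrite /rest; elim/big_ind: _ => [|f g df dg|j ji].
  - exact: is_derive_cst.
  - by apply: is_derive_eq; rewrite !scaler0 addr0.
  have dj := is_derive_coord i j x.
  by rewrite /F -exprfctE; apply: is_derive_eq; rewrite eq_sym (negPf ji) scaler0.
have dFi : is_derive x (delta_mx 0 i) (F i)
    ((nth 0%N m.2 i)%:R * x 0 i ^+ (nth 0%N m.2 i).-1).
  have di := is_derive_coord i i x.
  rewrite /F -exprfctE; apply: is_derive_eq.
  by rewrite eqxx /GRing.scale /= mulr1.
rewrite (_ : evm m = (m.1%:~R : R) \*: (F i * rest)); last first.
  apply/funext => y; rewrite /evm (bigD1 i) //=.
  by rewrite /GRing.scale/= /F fctE /rest fct_prodE.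
apply: is_derive_eq.
rewrite /evm (bigD1 i) //= nth_set_nth /= eqxx intrM scaler0 add0r.
rewrite /GRing.scale /= -!mulrA; congr (_ * _).
rewrite mulrC -mulrA; congr (_ * (_ * _)).
rewrite /rest fct_prodE; apply: eq_bigr => j ji.
by rewrite nth_set_nth /= ifN.
Qed.

(** The scalar t is kept apart from the polynomial because the coefficients of
    [ipoly] are integers while P is going to be scaled by real numbers. *)
Lemma partial_ev (i : 'I_n) (t : R) p :
  partial i (fun x => t * ev p x) = (fun x => t * ev (dpoly i p) x).
Proof.
apply/funext => x; rewrite /partial.
have dp : is_derive x (delta_mx 0 i) (ev p) (ev (dpoly i p) x).
  elim: p => [|m p IH].
    rewrite [X in is_derive _ _ _ X]/ev big_nil (_ : ev [::] = cst 0).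
      exact: is_derive_cst.
    by apply/funext => y; rewrite /ev big_nil.
  rewrite (_ : ev (m :: p) = evm m + ev p); last first.
    by apply/funext => y; rewrite /ev big_cons.
  have dm := is_derive_evm i m x.
  by apply: is_derive_eq; rewrite [RHS]/ev big_cons.
by rewrite [LHS](@deriveZ _ _ _ (ev p) t x _ ex_derive) derive_val.
Qed.

Lemma partials_ev (I : seq 'I_n) (t : R) p :
  partials I (fun x => t * ev p x) = (fun x => t * ev (dpolys (map val I) p) x).
Proof. by elim: I => //= i I ->; rewrite partial_ev. Qed.

Lemma smooth_ev (U : set 'rV[R]_n) (t : R) p :
  smooth_on U (fun x => t * ev p x).
Proof.
move=> I x _; rewrite partials_ev.
exact: (differentiableM (differentiable_cst t x) (differentiable_ev _ x)).
Qed.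

Lemma partial_cst (i : 'I_n) (c : R) : partial i (fun=> c) = (fun=> 0).
Proof. by apply/funext => x; rewrite /partial (derive_cst c). Qed.

Lemma partials_cst (I : seq 'I_n) (c : R) x :
  partials I (fun=> c) x = if I is [::] then c else 0.
Proof.
have partials0 (J : seq 'I_n) : partials J (fun=> 0 : R) = fun=> 0.
  by elim: J => //= i J ->; rewrite partial_cst.
elim/last_ind: I => // I i _; rewrite /partials foldr_rcons partial_cst.
by rewrite -/(partials I _) partials0; case: I.
Qed.

Lemma partial_coord (i a : 'I_n) :
  partial i (fun y : 'rV[R]_n => y 0 a) = fun=> (i == a)%:R.
Proof.
apply/funext => x; have dx := is_derive_coord i a x.
by rewrite /partial derive_val.
Qed.

(** Subtracting x_a times the value at the constant 1 removes the case of no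
    derivative at all. *)
Lemma partials_coord (a : 'I_n) (I : seq 'I_n) x :
  partials I (fun y : 'rV[R]_n => y 0 a) x - x 0 a * partials I (fun=> 1) x =
  (I == [:: a])%:R.
Proof.
rewrite partials_cst; elim/last_ind: I => [|I i _]; first by rewrite mulr1 subrr.
rewrite /partials foldr_rcons partial_coord -/(partials I _) partials_cst.
case: I => [|j I] /=; first by rewrite mulr0 subr0 eqseq_cons andbT.
by rewrite mulr0 subr0 eqseq_cons; case: I => [|k I]; rewrite andbF.
Qed.

End Evaluation.

(** * Vector fields of one-sink graphs *)

(** In all graphs below P^{ij} = t p_{ij} for a table p of integer
    polynomials; the entries of the table are indexed by natural numbers so
    that sums over all indices can be computed. *)
Definition scaled (R : realType) (n : nat) (p : nat -> nat -> ipoly) (t : R)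
  (i j : 'I_n) (x : 'rV[R]_n) : R := t * ev (p i j) x.

Section GraphField.
Variables (R : realType) (n : nat) (p : nat -> nat -> ipoly).
Implicit Types (G : graph 1) (a : 'I_n) (x : 'rV[R]_n).

Definition content G (idx : {ffun arrow G -> 'I_n}) (v : 'I_(gwedges G)) x : R :=
  ev (dpolys (map val (incoming idx (inr (inl v))))
             (p (idx (inl (v, false))) (idx (inl (v, true))))) x.

(** The a-th component of the first-order part of the operator encoded by G:
    a single arrow on the sink differentiates the argument exactly once. *)
Definition graph_field G a x : R :=
  \sum_(idx : {ffun arrow G -> 'I_n} | incoming idx (inl ord0) == [:: a])
    \prod_(v < gwedges G) content idx v x.

(** A combination of graphs may encode a derivation although its members have
    several arrows or none on the sink.  Applied to x_a, which is affine,
    graphs with several such arrows give 0; those without any are removed by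
    the second term, which has to vanish in total for a derivation. *)
Lemma graph_fieldE G t a x : is_kontsevich G ->
  graph_op G (scaled p t) (fun=> fun y => y 0 a) x
    - x 0 a * graph_op G (scaled p t) (fun=> fun=> 1) x =
  t ^+ gwedges G * graph_field G a x.
Proof.
move=> /eqP jG; rewrite /graph_op mulr_sumr -sumrB /graph_field.
rewrite [in RHS]big_mkcond /= mulr_sumr.
apply: eq_bigr => idx _; rewrite !big_ord1 !mulrA -!mulrBl.
rewrite [X in _ * _ * X]big1 ?mulr1; last first.
  by move=> v; have := ltn_ord v; rewrite {2}jG.
rewrite partials_coord.
have -> : \prod_(v < gwedges G)
    partials (incoming idx (inr (inl v)))
      (scaled p t (idx (inl (v, false))) (idx (inl (v, true)))) x =
    t ^+ gwedges G * \prod_(v < gwedges G) content idx v x.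
  rewrite -[X in t ^+ X]card_ord -prodr_const -big_split /=.
  by apply: eq_bigr => v _; rewrite /scaled partials_ev.
by case: eqP => _; rewrite ?mul1r// mul0r mulr0.
Qed.

Lemma graph_field_ev G a : exists q, graph_field G a = ev q.
Proof.
pose ispoly (f : 'rV[R]_n -> R) := exists q, f = ev q.
have ev_const c : ispoly (fun=> c%:~R).
  exists [:: (c, [::])]; apply/funext => x; rewrite /ev big_seq1 /evm /=.
  by rewrite big1 ?mulr1// => i _; rewrite nth_nil expr0.
have ev_D f g : ispoly f -> ispoly g -> ispoly (f \+ g).
  by move=> [q ->] [r ->]; exists (q ++ r); apply/funext => x; rewrite ev_cat.
have ev_M f g : ispoly f -> ispoly g -> ispoly (f \* g).
  by move=> [q ->] [r ->]; exists (pmul q r); apply/funext => x; rewrite ev_mul.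
rewrite (_ : graph_field G a = \sum_(idx : {ffun arrow G -> 'I_n} |
  incoming idx (inl ord0) == [:: a])
    \prod_(v < gwedges G) content idx v); last first.
  apply/funext => x; rewrite fct_sumE.
  by apply: eq_bigr => idx _; rewrite fct_prodE.
elim/big_ind: _ => //; first exact: (ev_const 0).
move=> idx _; elim/big_ind: _ => //; first exact: (ev_const 1).
by move=> v _; rewrite /content; eexists; apply/funext => x.
Qed.

Lemma graph_field_sink G a x :
  #|[pred e : arrow G | target e == inl ord0]| != 1%N -> graph_field G a x = 0.
Proof.
move=> sink; apply: big_pred0 => idx; apply: contraNF sink => /eqP inc.
have sz : size (incoming idx (inl ord0)) = 1%N by rewrite inc.
apply/eqP; apply: etrans sz; rewrite size_map enumT cardE /enum_mem !size_filter.
exact: eq_count.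
Qed.

End GraphField.

(** * Symmetries of graphs *)

Definition relabel w (s : 'I_w -> 'I_w) (u : gvertex 1 w 0) : gvertex 1 w 0 :=
  if u is inr (inl v) then inr (inl (s v)) else u.

Section Symmetry.
Variables (R : realType) (n : nat) (p : nat -> nat -> ipoly).
Hypothesis skew : forall i j, p i j = popp (p j i).
Hypothesis tadpole_free :
  forall (i j : 'I_n) (x : 'rV[R]_n), ev (dpoly i (p i j)) x = 0.
Implicit Types (a : 'I_n) (x : 'rV[R]_n).

Lemma ev_dpolys_skew I i j x :
  ev (dpolys I (p j i)) x = - ev (dpolys I (p i j)) x.
Proof. by rewrite skew dpolys_popp ev_opp. Qed.

Lemma ev_dpolys_tadpole (I : seq 'I_n) (i j : 'I_n) x :
  (i \in I) || (j \in I) -> ev (dpolys (map val I) (p i j)) x = 0.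
Proof.
wlog iI : i j / i \in I.
  move=> wl /orP[iI|jI]; first by rewrite wl ?iI.
  by rewrite ev_dpolys_skew wl ?jI// oppr0.
move=> _; rewrite (perm_dpolys _ (perm_map val (perm_to_rem iI))).
rewrite /= -dpolys_dpoly -[LHS]mul1r.
have /= <- := congr1 (fun f => f x) (partials_ev (rem i I) 1 (dpoly i (p i j))).
rewrite (_ : (fun _ => _) = fun=> 0); last first.
  by apply/funext => y; rewrite tadpole_free mulr0.
by rewrite partials_cst; case: rem.
Qed.

Lemma graph_field_tadpole (G : graph 1) v b a x :
  wtarget v b = inr (inl v) :> gvertex 1 (gwedges G) (gjacs G) ->
  graph_field p G a x = 0.
Proof.
move=> vb; apply: big1 => idx _; rewrite (bigD1 v) //= /content.
rewrite ev_dpolys_tadpole ?mul0r //.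
suff : idx (inl (v, b)) \in incoming idx (inr (inl v)).
  by case: b vb => _ ->; rewrite ?orbT.
by apply: map_f; rewrite mem_filter mem_enum andbT /= vb.
Qed.

(** A renumbering s of the internal vertices that also swaps the two arrows of
    v when [flip v] transports the assignments of indices from one graph to
    the other; the contents are the same up to one sign for each swap. *)
Lemma graph_field_iso w (wt wt' : 'I_w -> bool -> gvertex 1 w 0) jt jt'
    (s : {perm 'I_w}) (flip : 'I_w -> bool) a x :
  (forall v b, wt' (s v) (flip v (+) b) = relabel s (wt v b)) ->
  graph_field p (Graph wt' jt') a x =
  (\prod_v (-1) ^+ flip v) * graph_field p (Graph wt jt) a x.
Proof.
move=> iso; pose G := Graph wt jt; pose G' := Graph wt' jt'.
pose h (e : arrow G) : arrow G' :=
  match e with inl (v, b) => inl (s v, flip v (+) b) | inr e' => inr e' end.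
pose h' (e : arrow G') : arrow G :=
  match e with
  | inl (v, b) => let v' := (s^-1)%g v in inl (v', flip v' (+) b)
  | inr e' => inr e'
  end.
have hK : cancel h h'.
  by move=> [[v b]|//]; rewrite /h /h' /= permK addbA addbb.
have h'K : cancel h' h.
  by move=> [[v b]|//]; rewrite /h /h' /= permKV addbA addbb.
have relabel_inj : injective (@relabel w s).
  move=> [u|[u|u]] [v|[v|v]] //=; by [case=> ->|case=> /perm_inj ->].
pose carry (idx : {ffun arrow G -> 'I_n}) : {ffun arrow G' -> 'I_n} :=
  [ffun e => idx (h' e)].
have inc idx (u : gvertex 1 w 0) :
    perm_eq (@incoming n 1 G' (carry idx) (relabel s u)) (@incoming n 1 G idx u).
  rewrite /incoming.
  have enumE : perm_eq (enum {: arrow G'}) (map h (enum {: arrow G})).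
    apply: uniq_perm; rewrite ?enum_uniq ?(map_inj_uniq (can_inj hK)) ?enum_uniq //.
    move=> e; rewrite mem_enum; apply/esym/mapP.
    by exists (h' e); rewrite ?mem_enum.
  apply: (perm_trans (perm_map _ (perm_filter _ enumE))).
  have carryh l : map (carry idx) (map h l) = map idx l.
    by rewrite -map_comp; apply: eq_map => e; rewrite /= ffunE hK.
  rewrite filter_map carryh; apply: perm_map.
  rewrite (@eq_filter _ _ (fun e => @target 1 G e == u :> gvertex 1 w 0)) // => e /=.
  rewrite -[RHS](inj_eq relabel_inj); congr (_ == _).
  by case: e => [[v b]|[[]]] //; exact: iso.
rewrite /graph_field (reindex carry) /=; last first.
  exists (fun idx : {ffun arrow G' -> 'I_n} =>
            [ffun e => idx (h e)] : {ffun arrow G -> 'I_n}).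
    by move=> idx _; apply/ffunP => e; rewrite !ffunE hK.
  by move=> idx _; apply/ffunP => e; rewrite !ffunE h'K.
rewrite mulr_sumr; apply: eq_big => [idx|idx _].
  have := inc idx (inl ord0); rewrite /= => inc0.
  apply/eqP/eqP => e; first by apply: perm_small_eq => //; rewrite perm_sym -e.
  by apply: perm_small_eq => //; rewrite -e.
rewrite (reindex_inj (@perm_inj _ s)) /= -big_split /=; apply: eq_bigr => v _.
rewrite /content (perm_dpolys _ (perm_map val (inc idx (inr (inl v))))).
rewrite !ffunE /= permK.
by case: (flip v); rewrite /= ?mul1r // mulN1r ev_dpolys_skew.
Qed.

(** Swapping two arrows with the same target gives back the same graph, but
    with the opposite sign. *)
Lemma graph_field_double w (wt : 'I_w -> bool -> gvertex 1 w 0) jt v a x :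
  wt v false = wt v true -> graph_field p (Graph wt jt) a x = 0.
Proof.
move=> eqv; have iso u b : wt ((1%g : {perm 'I_w}) u) ((u == v) (+) b) =
    relabel (1%g : {perm 'I_w}) (wt u b).
  have id_relabel t : relabel (1%g : {perm 'I_w}) t = t :> gvertex 1 w 0.
    by case: t => [|[t|]] //=; rewrite perm1.
  by rewrite id_relabel perm1; case: eqVneq => [->|] //=; case: b.
have := graph_field_iso jt jt a x iso.
rewrite (bigD1 v) //= eqxx big1 => [|u /negPf ->] //.
rewrite mulr1 mulN1r => /eqP; rewrite -subr_eq0 opprK -mulr2n mulrn_eq0.
by move=> /eqP.
Qed.

End Symmetry.

(** * The graph with three internal vertices *)

Definition v0 : 'I_3 := @Ordinal 3 0 isT.
Definition v1 : 'I_3 := @Ordinal 3 1 isT.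
Definition v2 : 'I_3 := @Ordinal 3 2 isT.

(** In d_j d_l P^{ai} d_i d_m P^{jk} d_k P^{lm} the vertices v0, v1 and v2 carry
    the factors P^{ai}, P^{jk} and P^{lm}, and a is the index at the sink. *)
Definition triangle_target (v : 'I_3) (b : bool) : gvertex 1 3 0 :=
  match val v, b with
  | 0, false => inl ord0
  | 0, true => inr (inl v1)
  | 1, false => inr (inl v0)
  | 1, true => inr (inl v2)
  | _, false => inr (inl v0)
  | _, true => inr (inl v1)
  end.

Definition triangle : graph 1 :=
  @Graph 1 3 0 triangle_target (fun _ _ => inl ord0).

Lemma third_vertex (u u' : 'I_3) : u' != u ->
  exists2 u'', (u'' != u) && (u'' != u') &
    forall v, [|| v == u, v == u' | v == u''].
Proof.
have := ltn_ord u; have := ltn_ord u'; rewrite -val_eqE /= => lt lt' neq.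
(* The three vertices are 0, 1 and 2, whose sum is 3. *)
have lt3 : (3 - u - u' < 3)%N by lia.
exists (Ordinal lt3); first by rewrite -!val_eqE /=; lia.
by move=> v; have := ltn_ord v; rewrite -!val_eqE /=; lia.
Qed.

Section ThreeVertices.
Variables (R : realType) (n : nat) (p : nat -> nat -> ipoly).
Hypothesis skew : forall i j, p i j = popp (p j i).
Hypothesis tadpole_free :
  forall (i j : 'I_n) (x : 'rV[R]_n), ev (dpoly i (p i j)) x = 0.

(** Let u0 be the vertex whose arrow falls on the sink.  Its other arrow goes
    to some u1, and if u2 is the third vertex, the arrows of u1 have to go to
    u0 and u2, those of u2 to u0 and u1: any other choice creates a tadpole, a
    double arrow or a second arrow into the sink.  So the graph is [triangle]
    up to numbering and order of arrows. *)
Lemma graph_field_three (G : graph 1) : is_kontsevich G -> gwedges G = 3%N ->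
  exists c : R, forall a (x : 'rV[R]_n),
    graph_field p G a x = c * graph_field p triangle a x.
Proof.
case: G => w j wt jt; rewrite /is_kontsevich /= => /eqP j0 w3.
move: wt jt; rewrite {}j0 {}w3 => wt jt; set G := Graph wt jt.
have zero : (forall a (x : 'rV[R]_n), graph_field p G a x = 0) ->
    exists c : R, forall a (x : 'rV[R]_n),
      graph_field p G a x = c * graph_field p triangle a x.
  by move=> G0; exists 0 => a x; rewrite G0 mul0r.
have [/existsP[v /existsP[b /eqP tad]]|] :=
    boolP [exists v, exists b, wt v b == inr (inl v) :> gvertex 1 3 0].
  apply: zero => a x.
  exact: (@graph_field_tadpole _ _ _ skew tadpole_free G v b a x tad).
rewrite negb_exists => /forallP notad.
have [/existsP[v /eqP dbl]|] :=
    boolP [exists v, wt v false == wt v true :> gvertex 1 3 0].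
  by apply: zero => a x; exact: graph_field_double dbl.
rewrite negb_exists => /forallP nodbl.
have [/eqP/mem_card1[e sinkE]|sink] :=
    boolP (#|[pred e : arrow G | target e == inl ord0]| == 1%N); last first.
  by apply: zero => a x; exact: graph_field_sink.
have {sinkE} sinkE v b :
    (wt v b == inl ord0 :> gvertex 1 3 0) = (inl (v, b) == e).
  exact: sinkE (inl (v, b)).
case: e sinkE => [[u0 b0]|[[]]] // sinkE.
have wt0 : wt u0 b0 = inl ord0 by apply/eqP; rewrite sinkE.
have inner v b : (v, b) != (u0, b0) -> exists2 v', wt v b = inr (inl v') & v' != v.
  move=> vb; case wtE : (wt v b) => [s|[v'|[]]] //.
    have /eqP : wt v b = inl ord0 :> gvertex 1 3 0 by rewrite wtE (ord1 s).
    by rewrite sinkE => /eqP[e1 e2]; rewrite e1 e2 eqxx in vb.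
  exists v' => //; apply/eqP => e.
  by have := notad v; rewrite negb_exists => /forallP/(_ b); rewrite wtE e eqxx.
have [|u1 wt1 u10] := inner u0 (~~ b0).
  by rewrite xpair_eqE eqxx; case: (b0).
have [u2 /andP[u20 u21] third] := third_vertex u10.
(* The arrows of u go to t and u0, in one order or the other. *)
have pick u t b : u != u0 -> t != u -> t != u0 ->
    wt u b =
    inr (inl (if b == (wt u true == inr (inl t) :> gvertex 1 3 0) then t else u0)).
  move=> uu0 tu tu0.
  have other v : v != u -> v = t \/ v = u0.
    move: uu0 tu tu0; case/or3P: (third u) => /eqP->;
    case/or3P: (third t) => /eqP->; case/or3P: (third v) => /eqP->;
    rewrite ?eqxx //=; by [left|right].
  have [|vf wtf /other vfE] := inner u false; first by rewrite xpair_eqE (negPf uu0).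
  have [|vt wtt /other vtE] := inner u true; first by rewrite xpair_eqE (negPf uu0).
  have vft : vf <> vt by move=> e; have := nodbl u; rewrite wtf wtt e eqxx.
  have inlE (v v' : 'I_3) :
      (inr (inl v) == inr (inl v') :> gvertex 1 3 0) = (v == v') by [].
  have u0t : u0 == t = false by rewrite eq_sym (negPf tu0).
  rewrite wtt inlE; case: b; rewrite ?wtf ?wtt.
    by case: vtE => ->; rewrite ?eqxx ?u0t.
  by case: vtE vft => ->; rewrite ?eqxx ?u0t; case: vfE => ->.
pose verts := tnth [tuple u0; u1; u2].
have verts_inj : injective verts.
  by apply/tuple_uniqP; rewrite /= !inE !negb_or eq_sym u10 eq_sym u20 eq_sym u21.
pose flip := tnth [tuple b0; wt u1 true != inr (inl u2) :> gvertex 1 3 0;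
                         wt u2 true != inr (inl u1) :> gvertex 1 3 0].
exists (\prod_v (-1) ^+ flip v) => a x.
apply: (graph_field_iso skew _ _ _ _ (s := perm verts_inj)) => v b.
rewrite permE /flip (tnth_nth false).
have vertsE (k : 'I_3) : verts k = nth u0 [:: u0; u1; u2] k.
  by rewrite /verts (tnth_nth u0).
case: v => [[|[|[|//]]] lt3]; case: b;
  rewrite vertsE /triangle_target /= ?permE ?vertsE /= ?addbF ?addbT.
- exact: wt1.
- exact: wt0.
- by rewrite [LHS](pick u1 u2) //; case: (wt u1 true == _).
- by rewrite [LHS](pick u1 u2) //; case: (wt u1 true == _).
- by rewrite [LHS](pick u2 u1) //; [case: (wt u2 true == _)|rewrite eq_sym].
- by rewrite [LHS](pick u2 u1) //; [case: (wt u2 true == _)|rewrite eq_sym].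
Qed.

End ThreeVertices.

Definition triangle_poly n (p : nat -> nat -> ipoly) (a : nat) : ipoly :=
  psum n (fun i => psum n (fun j => psum n (fun k => psum n (fun l => psum n (fun m =>
    pmul (pmul (dpolys [:: j; l] (p a i)) (dpolys [:: i; m] (p j k)))
         (dpolys [:: k] (p l m))))))).

Lemma graph_field_triangle (R : realType) n p a (x : 'rV[R]_n) :
  graph_field p triangle a x = ev (triangle_poly n p a) x.
Proof.
pose arrows : seq (arrow triangle) :=
  [:: inl (v0, false); inl (v0, true); inl (v1, false); inl (v1, true);
      inl (v2, false); inl (v2, true)].
have arrowsE : perm_eq (enum {: arrow triangle}) arrows.
  apply: uniq_perm; rewrite ?enum_uniq // => e; rewrite mem_enum; apply/esym.
  by case: e => [[[[|[|[|//]]] lt3] []]|[[]]].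
have inc (idx : {ffun arrow triangle -> 'I_n}) u :
    perm_eq (incoming idx u) [seq idx e | e <- arrows & target e == u].
  exact/perm_map/perm_filter.
(* An assignment is determined by its values on the five arrows that do not
   fall on the sink. *)
pose mk (q : 'I_n * ('I_n * ('I_n * ('I_n * 'I_n)))) :
    {ffun arrow triangle -> 'I_n} :=
  let: (i, (j, (k, (l, m)))) := q in
  [ffun e => nth a [:: a; i; j; k; l; m] (index e arrows)].
pose ofmk (idx : {ffun arrow triangle -> 'I_n}) :=
  (idx (inl (v0, true)), (idx (inl (v1, false)), (idx (inl (v1, true)),
    (idx (inl (v2, false)), idx (inl (v2, true)))))).
have sinkE (idx : {ffun arrow triangle -> 'I_n}) :
    (incoming idx (inl ord0) == [:: a]) = (idx (inl (v0, false)) == a).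
  have := inc idx (inl ord0); rewrite /= => /perm_small_eq -> //.
  by rewrite eqseq_cons andbT.
rewrite /graph_field (reindex_onto mk ofmk) /=; last first.
  move=> idx; rewrite sinkE => /eqP idxa; apply/ffunP => e.
  rewrite /mk /ofmk ffunE.
  have : e \in arrows by rewrite -(perm_mem arrowsE) mem_enum.
  rewrite /arrows !inE; case/orP => [/eqP->|]; first exact: esym idxa.
  by do 4?[case/orP => [/eqP-> //|]]; move=> /eqP->.
rewrite (eq_bigl predT); last first.
  move=> [i [j [k [l m]]]]; rewrite sinkE /mk /ofmk !ffunE /=.
  by rewrite !eqxx.
pose F (i j k l m : 'I_n) := ev (dpolys [:: j : nat; l : nat] (p a i)) x
  * ev (dpolys [:: i : nat; m : nat] (p j k)) x * ev (dpolys [:: k : nat] (p l m)) x.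
transitivity (\sum_i \sum_j \sum_k \sum_l \sum_m F i j k l m); last first.
  rewrite ev_sum; apply: eq_bigr => i _; rewrite ev_sum; apply: eq_bigr => j _.
  rewrite ev_sum; apply: eq_bigr => k _; rewrite ev_sum; apply: eq_bigr => l _.
  by rewrite ev_sum; apply: eq_bigr => m _; rewrite !ev_mul.
rewrite (eq_bigr (fun q => F q.1 q.2.1 q.2.2.1 q.2.2.2.1 q.2.2.2.2)); last first.
  move=> [i [j [k [l m]]]] _ /=; rewrite !big_ord_recl big_ord0 mulr1 mulrA /F.
  have incE v s :
      perm_eq [seq mk (i, (j, (k, (l, m)))) e | e <- arrows & target e == v] s ->
      forall q, ev (dpolys (map val (incoming (mk (i, (j, (k, (l, m))))) v)) q) x =
                ev (dpolys (map val s) q) x.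
    by move=> vs q; rewrite (perm_dpolys _ (perm_map val (perm_trans (inc _ _) vs))).
  rewrite /content.
  rewrite (incE _ [:: j; l]); last by rewrite /= !ffunE.
  rewrite (incE _ [:: i; m]); last by rewrite /= !ffunE.
  rewrite (incE _ [:: k]); last by rewrite /= !ffunE.
  by rewrite !ffunE.
rewrite -(pair_bigA _ (fun i q => F i q.1 q.2.1 q.2.2.1 q.2.2.2)) /=.
apply: eq_bigr => i _; rewrite -(pair_bigA _ (fun j q => F i j q.1 q.2.1 q.2.2)) /=.
apply: eq_bigr => j _; rewrite -(pair_bigA _ (fun k q => F i j k q.1 q.2)) /=.
by apply: eq_bigr => k _; rewrite -(pair_bigA _ (fun l m => F i j k l m)).
Qed.

(** * The tetrahedral flow and the Schouten bracket on polynomial coefficients *)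

Definition jac_poly n (p : nat -> nat -> ipoly) a b c : ipoly :=
  psum n (fun s => pmul (dpoly s (p a b)) (p s c) ++ pmul (dpoly s (p b c)) (p s a)
                   ++ pmul (dpoly s (p c a)) (p s b)).

Definition gamma1_poly n (p : nat -> nat -> ipoly) i j : ipoly :=
  psum n (fun k => psum n (fun l => psum n (fun m =>
  psum n (fun k' => psum n (fun l' => psum n (fun m' =>
    pmul (pmul (pmul (dpolys [:: k; l; m] (p i j)) (dpoly l' (p k k')))
               (dpoly m' (p l l'))) (dpoly k' (p m m')))))))).

Definition gamma2_poly n (p : nat -> nat -> ipoly) i m : ipoly :=
  psum n (fun j => psum n (fun k => psum n (fun l =>
  psum n (fun k' => psum n (fun l' => psum n (fun m' =>
    pmul (pmul (pmul (dpolys [:: k; l] (p i j)) (dpolys [:: k'; l'] (p k m)))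
               (dpoly m' (p k' l))) (dpoly j (p m' l')))))))).

Definition schouten_poly n (p : nat -> nat -> ipoly) (v : nat -> ipoly) i j : ipoly :=
  psum n (fun s => pmul (p i s) (dpoly s (v j)) ++ popp (pmul (p j s) (dpoly s (v i)))
                   ++ popp (pmul (v s) (dpoly s (p i j)))).

Section PolynomialCoefficients.
Variables (R : realType) (n : nat) (p : nat -> nat -> ipoly).
Implicit Types (x : 'rV[R]_n).

Lemma partials_scaled (I : seq 'I_n) t i j x :
  partials I (scaled p t i j) x = t * ev (dpolys (map val I) (p i j)) x.
Proof. by rewrite /scaled partials_ev. Qed.

Lemma partial_scaled (s : 'I_n) t i j x :
  partial s (scaled p t i j) x = t * ev (dpoly s (p i j)) x.
Proof. exact: (partials_scaled [:: s]). Qed.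

Lemma Jac_scaled t a b c x :
  Jac (scaled p t) a b c x = t ^+ 2 * ev (jac_poly n p a b c) x.
Proof.
rewrite ev_sum mulr_sumr; apply: eq_bigr => s _.
by rewrite !partial_scaled !ev_cat !ev_mul /scaled; ring.
Qed.

Lemma Gamma1_scaled t i j x :
  Gamma1 (scaled p t) i j x = t ^+ 4 * ev (gamma1_poly n p i j) x.
Proof.
do 6![rewrite ev_sum mulr_sumr; apply: eq_bigr => ? _].
by rewrite partials_scaled !partial_scaled !ev_mul; ring.
Qed.

Lemma Gamma2_scaled t i j x :
  Gamma2 (scaled p t) i j x = t ^+ 4 * ev (gamma2_poly n p i j) x.
Proof.
do 6![rewrite ev_sum mulr_sumr; apply: eq_bigr => ? _].
by rewrite !partials_scaled !partial_scaled !ev_mul; ring.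
Qed.

Lemma partial_lincomb (T : Type) (r : seq T) (c : T -> R) (W : T -> 'rV[R]_n -> R) s x :
  (forall u, exists q, W u = ev q) ->
  partial s (fun y => \sum_(u <- r) c u * W u y) x =
  \sum_(u <- r) c u * partial s (W u) x.
Proof.
move=> Wev; elim: r => [|u r IH].
  rewrite big_nil (_ : (fun _ => _) = fun=> 0) ?partial_cst //.
  by apply/funext => y; rewrite big_nil.
rewrite big_cons -IH /partial.
have dW v y : differentiable (W v) y.
  by have [q ->] := Wev v; exact: differentiable_ev.
have dcW v y : differentiable (fun z => c v * W v z) y.
  exact: (differentiableM (differentiable_cst (c v) y) (dW v y)).
rewrite (_ : (fun y => \sum_(v <- u :: r) c v * W v y) =
    (c u \*: W u) + (fun y => \sum_(v <- r) c v * W v y)); last first.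
  by apply/funext => y; rewrite big_cons.
rewrite deriveD ?deriveZ //; first exact/diff_derivable/dW.
  exact/derivableZ/diff_derivable/dW.
apply: diff_derivable; elim: r {IH} => [|v r IH].
  rewrite (_ : (fun _ => _) = cst 0); first exact: differentiable_cst.
  by apply/funext => y; rewrite big_nil.
rewrite (_ : (fun y => \sum_(w <- v :: r) c w * W w y) =
    (fun y => c v * W v y) + (fun y => \sum_(w <- r) c w * W w y)); last first.
  by apply/funext => y; rewrite big_cons.
exact: differentiableD.
Qed.

Lemma schouten21_lincomb (T : Type) (r : seq T) (c : T -> R)
    (W : T -> 'I_n -> 'rV[R]_n -> R) t i j x :
  (forall u a, exists q, W u a = ev q) ->
  schouten21 (scaled p t) (fun a y => \sum_(u <- r) c u * W u a y) i j x =
  \sum_(u <- r) c u * t * schouten21 (scaled p 1) (W u) i j x.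
Proof.
move=> Wev; rewrite /schouten21.
under [RHS]eq_bigr do rewrite mulr_sumr.
rewrite exchange_big /=; apply: eq_bigr => s _.
rewrite !(partial_lincomb _ _ _ _ (fun u => Wev u _)) !mulr_sumr mulr_suml -!sumrB.
by apply: eq_bigr => u _; rewrite !partial_scaled /scaled; ring.
Qed.

Lemma schouten21_ev (v : nat -> ipoly) i j x :
  schouten21 (scaled p 1) (fun a => ev (v a)) i j x = ev (schouten_poly n p v i j) x.
Proof.
have partial_ev1 (s : 'I_n) q : partial s (ev q) x = ev (dpoly s q) x :> R.
  have := congr1 (fun f => f x) (partial_ev s 1 q); rewrite /= mul1r => <-.
  by congr (partial s _ x); apply/funext => y; rewrite mul1r.
rewrite ev_sum; apply: eq_bigr => s _.
by rewrite !ev_cat !ev_opp !ev_mul partial_scaled !partial_ev1 /scaled; ring.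
Qed.

Lemma schouten21_skew t (V : 'I_n -> 'rV[R]_n -> R) i j x :
  (forall k l, p k l = popp (p l k)) ->
  schouten21 (scaled p t) V j i x = - schouten21 (scaled p t) V i j x.
Proof.
move=> skew; rewrite /schouten21 -sumrN; apply: eq_bigr => s _.
rewrite !partial_scaled; have /= -> := ev_dpolys_skew skew [:: val s] i j x.
by ring.
Qed.

Lemma wedge_action_coord (T : 'I_n -> 'I_n -> 'rV[R]_n -> R) a b x :
  wedge_action T (fun y => y 0 a) (fun y => y 0 b) x = 2^-1 * (T a b x - T b a x).
Proof.
rewrite /wedge_action; congr (_ * _).
under eq_bigr => i _.
  under eq_bigr => j _ do rewrite !partial_coord mulrBr.
  rewrite sumrB (bigD1 b) //= eqxx mulr1 big1 ?addr0; last first.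
    by move=> j /negPf ->; rewrite !mulr0.
  rewrite (bigD1 a) //= eqxx mul1r big1 ?addr0; last first.
    by move=> j /negPf ->; rewrite mul0r mulr0.
  over.
rewrite sumrB (bigD1 a) //= eqxx mulr1 big1 ?addr0; last first.
  by move=> j /negPf ->; rewrite !mulr0.
rewrite (bigD1 b) //= eqxx mulr1 big1 ?addr0 //.
by move=> j /negPf ->; rewrite !mulr0.
Qed.

End PolynomialCoefficients.

(** Comparing coefficients of t^k: an identity between polynomials in t that
    holds for infinitely many t holds coefficientwise. *)
Lemma coef_power_sum (R : realType) (T : Type) (r : seq T) (c : T -> R)
    (w : T -> nat) k q :
  (forall t, t ^+ k * q = \sum_(u <- r) c u * t ^+ w u) ->
  q = \sum_(u <- r | w u == k) c u.
Proof.
move=> eqt; pose P := q *: 'X^k - \sum_(u <- r) c u *: 'X^(w u).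
have Pt t : P.[t] = 0.
  rewrite /P !(hornerE, horner_sum) mulrC eqt; apply/eqP; rewrite subr_eq0.
  by apply/eqP; apply: eq_bigr => u _; rewrite !hornerE.
have P0 : P = 0.
  apply/eqP/negPn/negP => Pn0.
  suff : (size [seq (i%:R : R) | i <- iota 0 (size P)] < size P)%N.
    by rewrite size_map size_iota ltnn.
  apply: max_poly_roots Pn0 _ _; first by apply/allP => y _; apply/eqP.
  by rewrite map_inj_uniq ?iota_uniq// => i j /eqP; rewrite eqr_nat => /eqP.
have := congr1 (coefp k) P0; rewrite /= coef0 coefB coefZ coefXn eqxx mulr1 => /eqP.
rewrite subr_eq0 coef_sum => /eqP ->; rewrite [RHS]big_mkcond.
by apply: eq_bigr => u _; rewrite coefZ coefXn eq_sym; case: eqP; rewrite ?mulr1 ?mulr0.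
Qed.

Lemma eq_big_all (R : nmodType) (T : Type) (r : seq T) (Q : pred T) (F F' : T -> R) :
  all Q r -> (forall u, Q u -> F u = F' u) -> \sum_(u <- r) F u = \sum_(u <- r) F' u.
Proof.
move=> Qr FF'; elim: r Qr => [|u r IH] /=; first by rewrite !big_nil.
by move=> /andP[Qu Qr]; rewrite !big_cons FF' // IH.
Qed.

(** * Euclidean space as an affine manifold *)

Section Euclidean.
Variables (R : realType) (n : nat).

(** The balls with rational centers and radii 1/(k+1) form a basis. *)
Lemma second_countable_rV : @second_countable 'rV[R]_n.
Proof.
pose f (c : 'rV[rat]_n * nat) : set 'rV[R]_n :=
  ball (map_mx ratr c.1 : 'rV[R]_n) c.2.+1%:R^-1.
exists (range f).
  exact: sub_countable (card_image_le _ _) (countableP _).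
split=> [_ [c _ <-]|x V /nbhs_ballP[_/posnumP[e] eV]]; first exact: ball_open.
have [k ke] : exists k : nat, k.+1%:R^-1 < e%:num / 2 :> R.
  have [//|k] := @ltr_add_invr R 0 (e%:num / 2); rewrite add0r => ke.
  by exists k.
have k0 : 0 < k.+1%:R^-1 :> R by rewrite invr_gt0.
have /choice[q qx] : forall i, exists q : rat, ball (ratr q : R) k.+1%:R^-1 (x 0 i).
  move=> i; have [|q] := @rat_in_itvoo R (x 0 i - k.+1%:R^-1) (x 0 i + k.+1%:R^-1).
    by rewrite ltrD2l gtrN.
  rewrite in_itv /= => qx; exists q; apply: ball_sym.
  by rewrite /ball /= ltr_distlC.
have xq : ball (map_mx ratr (\row_i q i) : 'rV[R]_n) k.+1%:R^-1 x.
  by split=> // i j; rewrite !mxE (ord1 i); exact: qx.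
exists (f (\row_i q i, k)); first by split=> //; exists (\row_i q i, k).
apply: subset_trans eV => y qy; rewrite [e%:num]splitr.
exact: ball_triangle (le_ball (ltW ke) (ball_sym xq)) (le_ball (ltW ke) qy).
Qed.

Definition euclidean : affine_manifold R n.
Proof.
refine (@AffineManifold R n 'rV[R]_n (@norm_hausdorff _ _) second_countable_rV unit
  (fun=> setT) (fun=> id) (fun=> id) _ _ _ _ _ _ _).
- by move=> p; exists tt.
- by move=> _; exact: openT.
- by move=> _; rewrite image_id; exact: openT.
- by [].
- by move=> _ p _; exact: cvg_id.
- by move=> _ x _; exact: cvg_id.
- move=> _ _ p _ _; exists 1%:M, 0.
  apply: (@filterE _ _ (nbhs_filter (p : 'rV[R]_n))) => q.
  by rewrite mulmx1 addr0.
Defined.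

Lemma transition_jacobian_euclidean a b p A :
  @transition_jacobian R n euclidean a b p A -> A = 1%:M.
Proof.
move=> [c /= /nbhs_ballP[_/posnumP[e] near_e]].
have pE : p = p *m A + c by apply: near_e; exact: ballxx.
have step (i : 'I_n) : delta_mx 0 i = delta_mx 0 i *m A :> 'rV[R]_n.
  pose q : 'rV[R]_n := p + (e%:num / 2) *: delta_mx 0 i.
  have qE : q = q *m A + c.
    apply: near_e; split=> // j k; rewrite !mxE /ball /=.
    rewrite opprD addNKr normrN normrM ger0_norm; last by rewrite divr_ge0.
    rewrite (le_lt_trans (_ : _ <= e%:num / 2)) ?ltr_pdivrMr ?ltr_pMr ?ltr1n //.
    by rewrite ler_piMr ?divr_ge0 // ger0_norm ?ler0n // lern1 leq_b1.
  have : (e%:num / 2) *: delta_mx 0 i =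
         (e%:num / 2) *: (delta_mx 0 i *m A) :> 'rV[R]_n.
    apply: (@addrI _ p); rewrite [LHS]qE [in RHS]pE /q mulmxDl -scalemxAl.
    by rewrite addrAC.
  by apply: scalerI; rewrite gt_eqF.
by apply/row_matrixP => i; rewrite rowE -step row1.
Qed.

Lemma smooth_coordinate (a : 'I_n) :
  @smooth_function R n euclidean (fun y : 'rV[R]_n => y 0 a).
Proof.
move=> []; rewrite /in_chart (_ : _ \o _ =
    fun y : 'rV[R]_n => 1 * ev [:: (1, rcons (nseq a 0%N) 1%N)] y).
  exact: smooth_ev.
apply/funext => y; rewrite mul1r /ev big_seq1 /evm mul1r (bigD1 a) //=.
rewrite nth_rcons size_nseq ltnn eqxx expr1 big1 ?mulr1 // => i ia.
rewrite nth_rcons size_nseq nth_nseq; case: ltngtP => // ai; rewrite ?expr0 //.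
by rewrite (val_inj ai) eqxx in ia.
Qed.

Lemma smooth_one : @smooth_function R n euclidean (fun=> 1).
Proof.
move=> []; rewrite /in_chart (_ : _ \o _ = fun y : 'rV[R]_n => 1 * ev [:: (1, [::])] y).
  exact: smooth_ev.
apply/funext => y; rewrite mul1r /ev big_seq1 /evm mul1r big1 // => i _.
by rewrite nth_nil expr0.
Qed.

Definition scaled_bivector (p : nat -> nat -> ipoly)
  (skew : forall i j, p i j = popp (p j i)) (t : R) : bivector euclidean.
Proof.
refine (@Bivector R n euclidean (fun=> scaled p t) _ _ _).
- by move=> a i j; exact: smooth_ev.
- by move=> a i j x _; rewrite /scaled skew ev_opp mulrN.
- move=> a b y A _ _ /transition_jacobian_euclidean -> k l.
  rewrite (bigD1 k) //= [X in _ + X]big1 ?addr0; last first.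
    by move=> i ik; rewrite big1 // => j _; rewrite !mxE (negPf ik) mulr0 mul0r.
  rewrite (bigD1 l) //= [X in _ + X]big1 ?addr0; last first.
    by move=> j jl; rewrite !mxE (negPf jl) mulr0.
  by rewrite !mxE !eqxx !mulr1.
Defined.

(** A derivation kills 1, so its value at x_a minus x_a times its value at 1 is
    its a-th component; [graph_fieldE] evaluates this graph by graph. *)
Lemma encoded_field_sum (p : nat -> nat -> ipoly) skew (X : seq (R * graph 1)) t
    (V : vector_field euclidean) a (x : 'rV[R]_n) :
  all (fun u => is_kontsevich u.2) X ->
  encodes_vector_field X (@scaled_bivector p skew t) V ->
  V tt a x = \sum_(u <- X) u.1 * t ^+ gwedges u.2 * graph_field p u.2 a x.
Proof.
move=> kX enc.
have imx : @am_img R n euclidean tt x by exists x.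
have Va : comb_op X (scaled p t) (fun=> fun y => y 0 a) x = V tt a x.
  rewrite [LHS](enc _ (smooth_coordinate a) tt x imx) (bigD1 a) //= big1 ?addr0.
    rewrite [X in _ * X](congr1 (fun f => f x) (partial_coord R a a)).
    by rewrite eqxx mulr1.
  move=> i ia; rewrite [X in _ * X](congr1 (fun f => f x) (partial_coord R i a)).
  by rewrite (negPf ia) mulr0.
have V1 : comb_op X (scaled p t) (fun=> fun=> 1) x = 0.
  rewrite [LHS](enc _ smooth_one tt x imx) big1 // => i _.
  by rewrite [X in _ * X](congr1 (fun f => f x) (partial_cst i 1)) mulr0.
rewrite -Va -[LHS]subr0 -[X in _ - X](mulr0 (x 0 a)) -[X in x 0 a * X]V1.
rewrite /comb_op mulr_sumr -sumrB; apply: eq_big_all kX _ => u ku.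
by rewrite mulrCA -mulrBr graph_fieldE // mulrA.
Qed.

Lemma leibniz_op_poisson (P : 'I_n -> 'I_n -> 'rV[R]_n -> R) (G : graph 2) args x :
  (forall a b c, Jac P a b c = fun=> 0) -> is_leibniz G -> graph_op G P args x = 0.
Proof.
move=> jacP /andP[jG _]; apply: big1 => idx _.
rewrite [X in _ * X](bigD1 (Ordinal jG)) //= jacP partials_cst.
by case: incoming => [|? ?]; rewrite mul0r mulr0.
Qed.

End Euclidean.

(** The universal field is a multiple of the field of [triangle], so the
    factorization reduces to one proportionality between integers, read off at
    the point (1, ..., 1). *)
Lemma factorization_proportional (R : realType) n (p : nat -> nat -> ipoly)
    (skew : forall i j, p i j = popp (p j i))
    (X : seq (R * graph 1)) (D : seq (R * graph 2)) :
  (forall (i j : 'I_n) (x : 'rV[R]_n), ev (dpoly i (p i j)) x = 0) ->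
  (forall t (a b c : 'I_n), Jac (scaled p t) a b c = fun=> 0 :> R) ->
  all (fun u => is_kontsevich u.2) X -> all (fun u => is_leibniz u.2) D ->
  (forall t, exists V : vector_field (euclidean R n),
     encodes_vector_field X (@scaled_bivector R n p skew t) V /\
     factorizes D (@scaled_bivector R n p skew t) V) ->
  exists C : R, forall a b : 'I_n,
    C * (sum_coefs (schouten_poly n p (triangle_poly n p) a b))%:~R =
    2^-1 *
    (1 / 4 * (sum_coefs (gamma1_poly n p a b) - sum_coefs (gamma1_poly n p b a))%:~R
   + 3 / 2 * (sum_coefs (gamma2_poly n p a b) - sum_coefs (gamma2_poly n p b a))%:~R).
Proof.
move=> tadpole_free jacobi kX lD sol.
have /choice[c cP] : forall G : graph 1, exists c : R,
    is_kontsevich G -> gwedges G = 3%N -> forall a (x : 'rV[R]_n),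
    graph_field p G a x = c * graph_field p triangle a x.
  move=> G; have [kG|nkG] := boolP (is_kontsevich G); last by exists 0.
  have [w3|nw3] := eqVneq (gwedges G) 3%N; last first.
    by exists 0 => _ w3; rewrite w3 in nw3.
  by have [c cP] := graph_field_three skew tadpole_free kG w3; exists c.
exists (\sum_(u <- X | gwedges u.2 == 3%N) u.1 * c u.2) => a b.
pose x : 'rV[R]_n := const_mx 1.
pose S (G : graph 1) := schouten21 (scaled p 1) (graph_field p G) a b x.
set q := RHS.
(* The bracket with P adds one more factor t. *)
have -> : q = \sum_(u <- X | (gwedges u.2).+1 == 4%N) u.1 * S u.2.
  apply: coef_power_sum => t; have [V [encV factV]] := sol t.
  have VE : V tt = fun d y =>
      \sum_(u <- X) (u.1 * t ^+ gwedges u.2) * graph_field p u.2 d y.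
    by apply/funext => d; apply/funext => y; exact: encoded_field_sum encV.
  have imx : @am_img R n (euclidean R n) tt x by exists x.
  have := factV _ _ (smooth_coordinate a) (smooth_coordinate b) tt x imx.
  rewrite [comb_op _ _ _ _](_ : _ = 0) ?addr0; last first.
    rewrite /comb_op (eq_big_all (F' := fun=> 0) lD) ?big1 // => u lu.
    by rewrite [X in _ * X](leibniz_op_poisson _ _ (jacobi t) lu) mulr0.
  rewrite !wedge_action_coord (schouten21_skew _ _ a b _ skew) VE.
  rewrite schouten21_lincomb; last by move=> u d; exact: graph_field_ev.
  rewrite /Q16 !Gamma1_scaled !Gamma2_scaled !ev_ones.
  set field_bracket := \sum_(u <- X) _ => eqt.
  transitivity field_bracket; last first.
    by apply: eq_bigr => u _; rewrite exprSr /S; ring.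
  have -> : field_bracket = 2^-1 * (field_bracket - - field_bracket) by field.
  by rewrite -eqt /q !intrB; field.
rewrite mulr_suml [LHS]big_mkcond [RHS]big_mkcond; apply: eq_big_all kX _ => u ku.
rewrite eqSS; case: eqP => // w3; rewrite -mulrA; congr (_ * _).
rewrite /S -(@ev_ones R n) -/x -schouten21_ev.
have -> : graph_field p u.2 =
    fun d (y : 'rV[R]_n) => \sum_(k <- [:: tt]) c u.2 * ev (triangle_poly n p d) y.
  apply/funext => d; apply/funext => y.
  by rewrite big_seq1 (cP _ ku w3) graph_field_triangle.
rewrite (@schouten21_lincomb R n p unit _ (fun=> c u.2)
  (fun=> fun d => ev (triangle_poly n p d))).
  by rewrite big_seq1 mulr1.
by move=> _ d; exists (triangle_poly n p d).
Qed.

(** * The Poisson structure on R^4 *)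

Definition nambu_upper (i j : nat) : ipoly :=
  match i, j with
  | 0, 1 => [:: (-1, [:: 0; 0; 1; 2]%N)]
  | 0, 2 => [:: (1, [:: 0; 2; 0; 2]%N)]
  | 0, 3 => [:: (-1, [:: 0; 2; 0; 0]%N)]
  | 1, 2 => [:: (-1, [:: 1; 0; 0; 2]%N)]
  | 1, 3 => [:: (1, [:: 1; 0; 0; 0]%N)]
  | _, _ => [::]
  end.

(** P^{ij} is the sum of eps^{ijkl} d_k C1 d_l C2 over k and l, for the
    Casimirs C1 = x2 + x3^3/3 and C2 = x0^2/2 + x1^3/3 + x2^2/2.  As C1 and C2
    are sums of functions of one variable, it involves x_k and x_l only. *)
Definition nambu (i j : nat) : ipoly :=
  if (i < j)%N then nambu_upper i j else popp (nambu_upper j i).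

Lemma nambu_skew i j : nambu i j = popp (nambu j i).
Proof.
rewrite /nambu; case: ltngtP => [||->]; rewrite ?poppK //.
by case: j => [|[|[|[|j]]]].
Qed.

Lemma ord_iota n (i : 'I_n) : val i \in iota 0 n.
Proof. by rewrite mem_iota ltn_ord. Qed.

Lemma nambu_tadpole_free (R : realType) (i j : 'I_4) (x : 'rV[R]_4) :
  ev (dpoly i (nambu i j)) x = 0.
Proof.
have /allP check : all (fun a => all (fun b =>
  collect (dpoly a (nambu a b)) == [::]) (iota 0 4)) (iota 0 4) by vm_compute.
have /allP/(_ _ (ord_iota j))/eqP e := check _ (ord_iota i).
by rewrite -ev_collect e /ev big_nil.
Qed.

Lemma nambu_jacobi (R : realType) (t : R) (a b c : 'I_4) :
  Jac (scaled nambu t) a b c = fun=> 0.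
Proof.
apply/funext => x; rewrite Jac_scaled.
have /allP check : all (fun a => all (fun b => all (fun c =>
  collect (jac_poly 4 nambu a b c) == [::]) (iota 0 4)) (iota 0 4)) (iota 0 4).
  by vm_compute.
have /allP/(_ _ (ord_iota b))/allP/(_ _ (ord_iota c))/eqP e := check _ (ord_iota a).
by rewrite -ev_collect e /ev big_nil mulr0.
Qed.

Theorem proposition5 (R : realType) :
  ~ exists (X : seq (R * graph 1)) (D : seq (R * graph 2)),
      all (fun t => is_kontsevich t.2) X /\
      all (fun t => is_leibniz t.2) D /\
      forall (n : nat) (N : affine_manifold R n) (P : bivector N),
        (2 <= n)%N ->
        exists V : vector_field N,
          encodes_vector_field X P V /\ factorizes D P V.
Proof.
move=> [X [D [kX [lD sol]]]].
have [C CE] := factorization_proportional (@nambu_tadpole_free R)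
  (@nambu_jacobi R) kX lD (fun t => sol _ _ (@scaled_bivector R 4 nambu nambu_skew t) isT).
have values (a b : 'I_4) s g1 g2 :
    sum_coefs (schouten_poly 4 nambu (triangle_poly 4 nambu) a b) = s ->
    sum_coefs (gamma1_poly 4 nambu a b) - sum_coefs (gamma1_poly 4 nambu b a) = g1 ->
    sum_coefs (gamma2_poly 4 nambu a b) - sum_coefs (gamma2_poly 4 nambu b a) = g2 ->
    C * s%:~R = 2^-1 * (1 / 4 * g1%:~R + 3 / 2 * g2%:~R).
  by move=> <- <- <-; exact: CE.
have component23 : C * 4%:~R = 2^-1 * (1 / 4 * 0%:~R + 3 / 2 * 0%:~R).
  by apply: (values (@Ordinal 4 2 isT) (@Ordinal 4 3 isT)); vm_compute.
have component13 : C * (-4)%:~R = 2^-1 * (1 / 4 * 0%:~R + 3 / 2 * (-4)%:~R).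
  by apply: (values (@Ordinal 4 1 isT) (@Ordinal 4 3 isT)); vm_compute.
lra.
Qed.
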